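(* Let $p$ be a prime and $\mathbb{F}$ an algebraically closed field of characteristic $p$. Let $X=[X,X]$ be a finite perfect group and $Q\subseteq X$ a $p$-radical subgroup, i.e. a $p$-subgroup with $\mathrm{O}_p(\mathrm{N}_X(Q))=Q$. Let $V$ be a simple $\mathbb{F}X$-module affording $\chi\in\mathrm{IBr}(X)$, such that (i) the fixed point module $V^Q:=\{v\in V\mid q.v=v \text{ for all } q\in Q\}$ is simple as an $\mathbb{F}\mathrm{N}_X(Q)$-module, affording $\psi\in\mathrm{IBr}(\mathrm{N}_X(Q))$; (ii) $\mathrm{Aut}(X)_{Q,\chi}=\mathrm{Aut}(X)_{Q,\psi}$. Then $(\chi,\psi)$ satisfies the cohomological condition with respect to $(X,\mathrm{N}_X(Q))$.
   Context: For a finite group $G$, $\mathrm{IBr}(G)$ is the set of isomorphism classes of simple $\mathbb{F}G$-modules (equivalently of irreducible $\mathbb{F}$-linear representations); a module or representation ''affords'' its class. $\mathrm{O}_p(G)$ is the largest normal $p$-subgroup of $G$. Automorphisms act on representations by ${}^\tau\mathcal{P}=\mathcal{P}\circ\tau^{-1}$, and subscripts denote (simultaneous) stabilizers: $\mathrm{Aut}(X)_\chi$ is the stabilizer of $\chi$, $\mathrm{Aut}(X)_{Q,\chi}$ (resp. $\mathrm{Aut}(X)_{Q,\psi}$) the group of automorphisms of $X$ stabilizing $Q$ and $\chi$ (resp. $Q$, hence $\mathrm{N}_X(Q)$, and $\psi$); for $Y\subseteq X$ and $\psi\in\mathrm{IBr}(Y)$, $\mathrm{Aut}(X)_{Y,\psi}$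 is the group of automorphisms stabilizing $Y$ and $\psi$, and $\mathrm{Aut}(X)_{Y,\psi,\chi}=\mathrm{Aut}(X)_{Y,\psi}\cap \mathrm{Aut}(X)_\chi$. A (normalized) projective representation of a group $G$ is a map $\mathcal{P}\colon G\to\mathrm{GL}_n(\mathbb{F})$ with $\mathcal{P}(1)=\mathrm{Id}_n$ such that $\mathcal{P}(g)\mathcal{P}(g')=\alpha_{\mathcal{P}}(g,g')\mathcal{P}(gg')$ for all $g,g'$, for some (unique) cocycle $\alpha_{\mathcal{P}}\in \mathrm{Z}^2(G,\mathbb{F}^\times)$. Cohomological condition: given finite groups $X\supseteq Y\supseteq Z=\mathrm{Z}(X)$ and $(\chi,\psi)\in\mathrm{IBr}(X)\times\mathrm{IBr}(Y)$, the pair $(\chi,\psi)$ satisfies it with respect to $(X,Y)$ if there are (normalized) projective representations $\mathcal{P}$ of $\mathrm{Aut}(X)_\chi$ and $\mathcal{Q}$ of $\mathrm{Aut}(X)_{Y,\psi}$ such that, identifying $X/Z$ with the subgroup of inner automorphisms in $\mathrm{Aut}(X)$: (i) the restriction of $\mathcal{P}$ to $X/Z$ is $\mathcal{L}\circ\mathbf{s}$, where $\mathbf{s}\colon X/Z\to X$ is a section of the quotient map $X\to X/Z$ with $\mathbf{s}(1)=1$, and $\mathcal{L}$ is a linear representation of $X$ affording $\chi$; (i') the restriction of $\mathcal{Q}$ to $Y/Z$ is $\mathcal{M}\circ\mathbf{t}$, where $\mathbf{t}\colon Y/Z\to Y$ is the restriction of $\mathbf{s}$, and $\mathcal{M}$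 is a linear representation of $Y$ affording $\psi$; (ii) the restrictions of $\mathcal{P}$ and $\mathcal{Q}$ to $\mathrm{Aut}(X)_{Y,\psi,\chi}$ have the same cocycle in $\mathrm{Z}^2(\mathrm{Aut}(X)_{Y,\psi,\chi},\mathbb{F}^\times)$. *)

(* Defs.v *)
From mathcomp Require Import all_boot all_order all_algebra all_fingroup.
From mathcomp Require Import all_solvable all_character.
From mathcomp Require Import boolp.

Set Implicit Arguments.
Unset Strict Implicit.
Unset Printing Implicit Defensive.

Import GroupScope GRing.Theory.
Local Open Scope ring_scope.

(* Conventions. As everywhere in MathComp, modules are right modules (row
   vectors), automorphisms (permutations of gT that are trivial outside X)
   act on the right, so that (a * b) x = b (a x), and the inner automorphism
   conj_aut X x is y |-> x^-1 y x. These choices are mutually consistent: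
   a |-> a^-1 identifies this group with the group of automorphisms under
   composition, and conj_aut X x with y |-> x y x^-1.
   An element of IBr(G) is given by an irreducible representation, taken up to
   similarity mx_rsim: a representation affords the class of rG when it is
   similar to rG. *)

Section Stabilizers.

Variables (F : fieldType) (gT : finGroupType).

Section Twist.

Variables (G : {group gT}) (n : nat) (rG : mx_representation F G n).
Variables (a : {perm gT}) (aG : a \in Aut G).

Lemma aut_repr_proof : mx_repr G (fun x => rG ((a^-1)%g x)).
Proof.
have aVG : (a^-1)%g \in Aut G by rewrite groupV.
split=> [|x y Gx Gy].
  by rewrite -(autmE aVG) morph1 repr_mx1.
rewrite -(autmE aVG) morphM // repr_mxM //.
- by rewrite /= autmE Aut_closed.
- by rewrite /= autmE Aut_closed.
Qed.

Definition aut_repr : mx_representation F G n := MxRepresentation aut_repr_proof.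

End Twist.

(* Aut(G)_chi, where chi is the class of rG *)
Definition Aut_stab (G : {group gT}) n (rG : mx_representation F G n) :
    {set {perm gT}} :=
  [set a in Aut G | `[< exists aG : a \in Aut G, mx_rsim (aut_repr rG aG) rG >]].

Lemma Aut_stabP (G : {group gT}) n (rG : mx_representation F G n)
    (a : {perm gT}) :
  a \in Aut_stab rG <->
  exists aG : a \in Aut G, mx_rsim (aut_repr rG aG) rG.
Proof.
rewrite inE; split=> [/andP[_ /asboolP] // | h].
by apply/andP; split; [case: h | apply/asboolP].
Qed.

Lemma Aut_stab_group_set (G : {group gT}) n (rG : mx_representation F G n) :
  group_set (Aut_stab rG).
Proof.
apply/group_setP; split=> [|a b].
  apply/Aut_stabP; exists (group1 _); exists 1%:M => //.
    by rewrite row_free_unit unitmx1.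
  by move=> x Gx; rewrite /= invg1 perm1 mulmx1 mul1mx.
move=> /Aut_stabP[aG [B _ fB hB]] /Aut_stabP[bG [C _ fC hC]].
apply/Aut_stabP; exists (groupM aG bG); exists (B *m C) => //.
  by rewrite row_free_unit unitmx_mul -!row_free_unit fB fC.
move=> x Gx; rewrite /= invMg permM.
have GbV : (b^-1)%g x \in G by rewrite Aut_closed // groupV.
by have /= hB' := hB _ GbV; have /= hC' := hC _ Gx; rewrite mulmxA hB' -!mulmxA hC'.
Qed.

Canonical Aut_stab_group (G : {group gT}) n (rG : mx_representation F G n) :=
  group (Aut_stab_group_set rG).

(* Aut(X)_{Y, psi}, where psi is the class of rY: the morphism restr_perm Y has
   domain 'N(Y | 'P), so this is the set of the automorphisms of X that
   stabilize Y and whose restriction to Y lies in Aut(Y)_psi. *)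
Definition Aut_sub_stab (X Y : {group gT}) n (rY : mx_representation F Y n) :
    {set {perm gT}} :=
  Aut X :&: restr_perm Y @*^-1 (Aut_stab rY).

Canonical Aut_sub_stab_group (X Y : {group gT}) n
    (rY : mx_representation F Y n) :=
  [group of Aut_sub_stab X rY].

End Stabilizers.

Section Projective.

Variables (F : fieldType) (aT : finGroupType).

(* alpha restricts to a 2-cocycle of D in the units of F, with trivial action *)
Definition cocycle2 (D : {group aT}) (alpha : aT -> aT -> F) : Prop :=
  {in D &, forall g h, alpha g h != 0} /\
  {in D & &, forall g h k,
     alpha g h * alpha (g * h)%g k = alpha g (h * k)%g * alpha h k}.

(* P is a normalized projective representation of D with cocycle alpha; the
   values of P and alpha outside D are irrelevant. *)
Definition projective_repr (D : {group aT}) n (P : aT -> 'M[F]_n)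
    (alpha : aT -> aT -> F) : Prop :=
  [/\ P 1%g = 1%:M,
      {in D, forall g, P g \in unitmx},
      cocycle2 D alpha
    & {in D &, forall g h, P g *m P h = alpha g h *: P (g * h)%g}].

End Projective.

(* The cohomological condition, for 'Z(X) \subset Y \subset X and irreducible
   chi and psi. The element 'Z(X) x of X / 'Z(X) is identified with
   conj_aut X x, which does not depend on the choice of x in its coset. *)
Definition cohomological_condition (F : fieldType) (gT : finGroupType)
    (X Y : {group gT}) n m
    (chi : mx_representation F X n) (psi : mx_representation F Y m) : Prop :=
  exists (P : {perm gT} -> 'M[F]_n) (alpha : {perm gT} -> {perm gT} -> F)
         (R : {perm gT} -> 'M[F]_m) (beta : {perm gT} -> {perm gT} -> F)
         (s : coset_of 'Z(X) -> gT)
         (L : mx_representation F X n) (M : mx_representation F Y m),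
    [/\ projective_repr [group of Aut_stab chi] P alpha
          /\ projective_repr [group of Aut_sub_stab X psi] R beta,
        s 1%g = 1%g
          /\ {in (X / 'Z(X))%g, forall c, s c \in X /\ coset 'Z(X) (s c) = c},
        mx_rsim L chi
          /\ {in X, forall x, P (conj_aut X x) = L (s (coset 'Z(X) x))},
        mx_rsim M psi
          /\ {in Y, forall y, R (conj_aut X y) = M (s (coset 'Z(X) y))}
      & {in Aut_sub_stab X psi :&: Aut_stab chi &, alpha =2 beta}].

Section FixedPoints.

Variables (F : fieldType) (gT : finGroupType) (X Q : {group gT}).
Variables (n : nat) (rX : mx_representation F X n) (sQX : Q \subset X).

Lemma fixed_module :
  mxmodule (subg_repr rX (subsetIl X 'N(Q))) (rfix_mx rX Q).
Proof.
exact: (normal_rfix_mx_module (subg_repr rX (subsetIl X 'N(Q)))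
          (normalSG sQX)).
Qed.

(* V^Q as a module for 'N_X(Q), where V is the module given by rX *)
Definition fixed_repr :
    mx_representation F 'N_X(Q)%G (\rank (rfix_mx rX Q)) :=
  submod_repr fixed_module.

End FixedPoints.

(* Main.v *)
Require Import Defs.
From mathcomp Require Import all_boot all_order all_algebra all_fingroup.
From mathcomp Require Import all_solvable all_character.
From mathcomp Require boolp.
Import GroupScope GRing.Theory.
Local Open Scope ring_scope.

(** The point is that one family of operators on V serves both projective
    representations. An automorphism [a] of [X] fixes the class [chi] exactly
    when some invertible [P a] on V intertwines [chi] with its twist by [a].
    For [a] and [b] in [Aut(X)_chi], both [P a *m P b] and [P (a * b)]
    intertwine [chi] with its twist by [a * b], so by Schur's lemma they differ
    by a nonzero scalar [alpha a b]: thus [P] is a projective representation.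
    When [a] is the inner automorphism given by [x], the operator [chi x] is an
    intertwiner, so [P] may be prescribed to be [chi] composed with a section on
    inner automorphisms (lemmas [section_intertwiner] and
    [projective_intertwiner_exists]).

    If [a] also stabilizes [Q], then [P a] maps the fixed points V^Q into
    themselves ([rfix_mx_stable_intertwiner]), and restricting the identity
    [P a *m P b = alpha a b *: P (a * b)] to V^Q shows that the restrictions of
    the [P a] form a projective representation with the same cocycle. As [P]
    restricts on inner automorphisms to [chi] composed with a section, its
    restriction to V^Q gives the module V^Q composed with that section.

    It remains to see that this covers all of [Aut(X)_{N_X(Q), psi}]. Since
    [Q = O_p(N_X(Q))] is characteristic in [N_X(Q)], an automorphism that
    stabilizes [N_X(Q)] stabilizes [Q] ([Aut_sub_stab_char]); the assumed
    equality of stabilizers then puts it in [Aut(X)_chi]. *)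

(** * Intertwiners and Schur's lemma *)

(** [A] transports [chi] to its composite with [a] rather than with [a^-1]: in
    this direction the product of two intertwiners follows the product of the
    automorphisms without reversal. *)
Definition intertwines {F : fieldType} {gT : finGroupType} {X : {group gT}}
    {n : nat} (chi : mx_representation F X n) (a : {perm gT}) (A : 'M[F]_n) :=
  {in X, forall x, chi x *m A = A *m chi (a x)}.

Lemma Aut_stab_intertwiner {F : fieldType} {gT : finGroupType}
    {X : {group gT}} {n} {chi : mx_representation F X n} {a : {perm gT}} :
  a \in Aut_stab chi -> exists2 A, A \in unitmx & intertwines chi a A.
Proof.
case/Aut_stabP=> aX [A _ freeA simA]; exists A; first by rewrite -row_free_unit.
by move=> x Xx; rewrite -simA ?Aut_closed //= permK.
Qed.

Lemma intertwinesM {F : fieldType} {gT : finGroupType} {X : {group gT}} {n}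
    {chi : mx_representation F X n} {a b : {perm gT}} {A B : 'M[F]_n} :
  a \in Aut X -> intertwines chi a A -> intertwines chi b B ->
  intertwines chi (a * b)%g (A *m B).
Proof.
move=> aX tA tB x Xx.
by rewrite mulmxA tA // -[LHS]mulmxA tB ?Aut_closed // permM mulmxA.
Qed.

(** [A *m invmx B] commutes with [chi], which is absolutely irreducible because
    the field is closed; Schur's lemma makes it scalar. *)
Lemma intertwines_scalar {F : closedFieldType} {gT : finGroupType}
    {X : {group gT}} {n} {chi : mx_representation F X n} {a : {perm gT}}
    {A B : 'M[F]_n} :
  mx_irreducible chi -> B \in unitmx ->
  intertwines chi a A -> intertwines chi a B -> exists c, A = c *: B.
Proof.
move=> irr uB tA tB.
have absI : mx_absolutely_irreducible chi by apply: group_closure_closed_field.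
have cAB : centgmx chi (A *m invmx B).
  apply/centgmxP=> x Xx; rewrite [RHS]mulmxA tA // -!mulmxA; congr (_ *m _).
  by apply: (canRL (mulmxK uB)); rewrite -mulmxA tB // mulKmx.
have /is_scalar_mxP[c defc] := mx_abs_irr_cent_scalar absI cAB.
by exists c; rewrite -mul_scalar_mx -defc mulmxKV.
Qed.

(** Associativity of matrix multiplication is the cocycle identity; the
    positive dimension is what allows scalars to be compared. *)
Lemma cocycle2_mul {F : fieldType} {aT : finGroupType} {D : {group aT}} {n}
    {P : aT -> 'M[F]_n} {alpha : aT -> aT -> F} :
  (0 < n)%N -> {in D, forall g, P g \in unitmx} ->
  {in D &, forall g h, P g *m P h = alpha g h *: P (g * h)%g} ->
  cocycle2 D alpha.
Proof.
move=> n_gt0 uP mulP.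
have nzP A : A \in unitmx -> (A : 'M[F]_n) != 0.
  apply: contraTneq => ->; rewrite -row_free_unit /row_free mxrank0.
  by rewrite eq_sym -lt0n.
split=> [g h Dg Dh | g h k Dg Dh Dk].
  have: P g *m P h != 0 by rewrite nzP // unitmx_mul !uP.
  by rewrite mulP // scaler_eq0 => /norP[].
have nzPghk : P (g * h * k)%g != 0 by rewrite nzP ?uP ?groupM.
suff: (alpha g h * alpha (g * h)%g k - alpha g (h * k)%g * alpha h k)
         *: P (g * h * k)%g = 0.
  by move/eqP; rewrite scaler_eq0 (negPf nzPghk) orbF subr_eq0 => /eqP.
apply/eqP; rewrite scalerBl subr_eq0 -!scalerA -mulP ?groupM // scalemxAl -mulP //.
rewrite -mulmxA (mulP h k) // -scalemxAr mulP ?groupM // mulgA scalerA mulrC.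
by rewrite scalerA.
Qed.

(** * The projective representation on V *)

(** This makes an operator prescribed through the coset of [x] depend only on
    the inner automorphism that [x] induces. *)
Lemma conj_aut_coset_inj {gT : finGroupType} {X : {group gT}} {x y : gT} :
  x \in X -> y \in X -> conj_aut X x = conj_aut X y ->
  coset 'Z(X) x = coset 'Z(X) y.
Proof.
move=> Xx Xy eq_xy.
have nX := subsetP (normG X).
have Zxy : (x * y^-1)%g \in 'Z(X).
  rewrite inE groupM ?groupV //= -ker_conj_aut; apply/kerP.
    by rewrite groupM ?groupV ?nX.
  by rewrite morphM ?groupV ?nX // morphV ?nX //= eq_xy mulgV.
by rewrite -[x in LHS](mulgKV y) (coset_kerl y Zxy).
Qed.

Lemma repr_coset_center {gT : finGroupType} {X : {group gT}} {x : gT} :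
  x \in X -> exists2 z, z \in 'Z(X) & repr (coset 'Z(X) x) = (z * x)%g.
Proof.
move=> Xx; have nZx := subsetP (normal_norm (center_normal X)) x Xx.
by apply: kercoset_rcoset nZx (coset_reprK _); apply: repr_coset_norm.
Qed.

Lemma repr_coset_mem {gT : finGroupType} {X : {group gT}} {x : gT} :
  x \in X -> repr (coset 'Z(X) x) \in X.
Proof.
by move=> Xx; have [z /centerP[Xz _] ->] := repr_coset_center Xx; rewrite groupM.
Qed.

(** The representative of a coset of the centre differs from [x] by a central
    element, so it induces the same inner automorphism. *)
Lemma section_intertwiner {F : fieldType} {gT : finGroupType} {X : {group gT}}
    {n} (chi : mx_representation F X n) {x : gT} :
  x \in X ->
  intertwines chi (conj_aut X x) (chi (repr (coset 'Z(X) x))).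
Proof.
move=> Xx y Xy; have [z Zz ->] := repr_coset_center Xx.
have /centerP[Xz cXz] := Zz.
rewrite conj_autE // -!repr_mxM ?groupM ?groupJ // ?groupV //.
by rewrite -mulgA -conjgC !mulgA (cXz y Xy).
Qed.

Lemma projective_intertwiner_exists {F : closedFieldType} {gT : finGroupType}
    {X : {group gT}} {n} (chi : mx_representation F X n) :
  mx_irreducible chi ->
  exists (P : {perm gT} -> 'M[F]_n) (alpha : {perm gT} -> {perm gT} -> F),
    [/\ projective_repr [group of Aut_stab chi] P alpha,
        {in Aut_stab chi, forall a, intertwines chi a (P a)}
      & {in X, forall x, P (conj_aut X x) = chi (repr (coset 'Z(X) x))}].
Proof.
move=> irr; have /mx_irrP[n_gt0 _] := irr.
have /boolp.choice[P defP] (a : {perm gT}) : exists A : 'M[F]_n,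
      (a \in Aut_stab chi -> A \in unitmx /\ intertwines chi a A)
   /\ {in X, forall x, a = conj_aut X x -> A = chi (repr (coset 'Z(X) x))}.
  have [[x Xx ->] | not_inner] := boolp.EM (exists2 x, x \in X & a = conj_aut X x).
    exists (chi (repr (coset 'Z(X) x))); split=> [_ | y Xy eq_xy].
      split; last exact: section_intertwiner.
      exact: repr_mx_unit (repr_coset_mem Xx).
    by rewrite (conj_aut_coset_inj Xx Xy eq_xy).
  have [aS | not_aS] := boolP (a \in Aut_stab chi).
    have [A uA tA] := Aut_stab_intertwiner aS.
    by exists A; split=> // x Xx eq_a; case: not_inner; exists x.
  by exists 0; split=> [/negP | x Xx eq_a]; [| case: not_inner; exists x].
have uP a : a \in Aut_stab chi -> P a \in unitmx by move=> aS; case: (defP a).1.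
have tP a : a \in Aut_stab chi -> intertwines chi a (P a).
  by move=> aS; case: ((defP a).1 aS).
have P_inner : {in X, forall x, P (conj_aut X x) = chi (repr (coset 'Z(X) x))}.
  by move=> x Xx; apply: (defP _).2.
have /boolp.choice[alpha mulP] (ab : {perm gT} * {perm gT}) : exists c : F,
    ab.1 \in Aut_stab chi -> ab.2 \in Aut_stab chi ->
    P ab.1 *m P ab.2 = c *: P (ab.1 * ab.2)%g.
  have [[aS bS] | not_S] :=
      boolp.EM (ab.1 \in Aut_stab chi /\ ab.2 \in Aut_stab chi); last first.
    by exists 0 => aS bS; case: not_S.
  have abS := groupM aS bS.
  have aX : ab.1 \in Aut X by case/setIdP: aS.
  have [c defc] := intertwines_scalar irr (uP _ abS)
    (intertwinesM aX (tP _ aS) (tP _ bS)) (tP _ abS).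
  by exists c.
pose alpha2 a b := alpha (a, b).
have mulP2 : {in [group of Aut_stab chi] &, forall a b,
    P a *m P b = alpha2 a b *: P (a * b)%g}.
  by move=> a b aS bS; apply: (mulP (a, b)).
exists P, alpha2; split=> //; split=> //; last exact: cocycle2_mul mulP2.
rewrite -(morph1 [morphism of conj_aut X]) P_inner // morph1 repr_coset1.
exact: repr_mx1.
Qed.

(** * Restriction to the fixed points *)

(** The matrix of the action of [A] on the row space of [U], in the basis used
    by [submod_repr]. *)
Definition restrict_mx {F : fieldType} {n} (U A : 'M[F]_n) : 'M_(\rank U) :=
  in_submod U (val_submod 1%:M *m A).

Lemma restrict_mxM {F : fieldType} {n} {U A B : 'M[F]_n} :
  (U *m A <= U)%MS -> restrict_mx U A *m restrict_mx U B = restrict_mx U (A *m B).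
Proof.
move=> UA; rewrite /restrict_mx.
set v1 := val_submod 1%:M.
have v1A : (v1 *m A <= U)%MS by rewrite (eqmxMr A (val_submod1 U)).
transitivity (in_submod U (val_submod (in_submod U (v1 *m A)) *m B)).
  by rewrite val_submodE [RHS]in_submodE [in_submod U (v1 *m B)]in_submodE !mulmxA.
by rewrite in_submodK // [in RHS]mulmxA.
Qed.

(** If [Q] fixes [v] then [v *m A] is fixed by [a @: Q], which is [Q]. *)
Lemma rfix_mx_stable_intertwiner {F : fieldType} {gT : finGroupType}
    {X Q : {group gT}} {n} {chi : mx_representation F X n} {a : {perm gT}}
    {A : 'M[F]_n} :
  Q \subset X -> a \in 'N(Q | 'P) -> intertwines chi a A ->
  (rfix_mx chi Q *m A <= rfix_mx chi Q)%MS.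
Proof.
move=> sQX nQa tA; apply/rfix_mxP=> y Qy.
have Qx : (a^-1)%g y \in Q by rewrite -(astabs_act _ nQa) /= /aperm permKV.
rewrite -mulmxA -[y in chi y](permKV a) -tA ?(subsetP sQX) //.
by rewrite mulmxA rfix_mx_id.
Qed.

(** The restricted operators satisfy the same multiplication rule, with the same
    scalars. Their invertibility then needs no dimension argument: the operators
    of [g] and [g^-1] multiply to a nonzero scalar. *)
Lemma projective_repr_restrict {F : fieldType} {aT : finGroupType}
    {D E : {group aT}} {n} {U : 'M[F]_n} {P : aT -> 'M[F]_n} {alpha} :
  E \subset D -> {in E, forall a, U *m P a <= U}%MS ->
  projective_repr D P alpha ->
  projective_repr E (fun a => restrict_mx U (P a)) alpha.
Proof.
move=> /subsetP sED UP [P1 uP [nz_alpha assoc_alpha] mulP].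
have R1 : restrict_mx U (P 1%g) = 1%:M by rewrite P1 /restrict_mx mulmx1 val_submodK.
have mulR : {in E &, forall g h, restrict_mx U (P g) *m restrict_mx U (P h)
                                 = alpha g h *: restrict_mx U (P (g * h)%g)}.
  move=> g h Eg Eh; rewrite restrict_mxM ?UP // mulP ?sED //.
  by rewrite /restrict_mx -scalemxAr linearZ.
split=> // [g Eg|].
  have EgV := groupVr Eg; have nz := nz_alpha _ _ (sED _ Eg) (sED _ EgV).
  have := mulR g _ Eg EgV; rewrite mulgV R1 => /(canLR (scalerK nz)).
  by rewrite scalemxAr => /mulmx1_unit[].
split=> [g h Eg Eh | g h k Eg Eh Ek]; [exact: nz_alpha (sED _ _) (sED _ _) |].
by apply: assoc_alpha; apply: sED.
Qed.

(** * Stabilizers *)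

(** An automorphism of [X] that stabilizes [Y] induces one of [Y], which preserves
    the characteristic subgroups of [Y]. *)
Lemma Aut_sub_stab_char {F : fieldType} {gT : finGroupType}
    {X Y H : {group gT}} {m} (psi : mx_representation F Y m) :
  H \char Y -> Aut_sub_stab X psi \subset 'N_(Aut X)(H | 'P).
Proof.
case/andP=> /subsetP sHY /forall_inP chHY; apply/subsetP=> a.
case/setIP=> aX /morphpreP[nYa /setIdP[rY _]].
rewrite inE aX !inE /=; apply/subsetP=> h Hh; rewrite inE /= /aperm.
rewrite -(restr_permE nYa (sHY h Hh)); apply: subsetP (chHY _ rY) _ _.
exact: imset_f.
Qed.

Theorem proposition4p1 (p : nat) (F : closedFieldType) (gT : finGroupType)
    (X Q : {group gT}) (n m : nat)
    (chi : mx_representation F X n) (psi : mx_representation F 'N_X(Q)%G m)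
    (p_prime : prime p) (charF : p \in [pchar F])
    (X_perfect : [~: X, X] = X :> {set gT})
    (sQX : Q \subset X) (pQ : p.-group Q)
    (Q_radical : 'O_p('N_X(Q)) = Q :> {set gT})
    (chi_irr : mx_irreducible chi)
    (VQ_simple : mx_irreducible (fixed_repr chi sQX))
    (VQ_psi : mx_rsim (fixed_repr chi sQX) psi)
    (stab_eq : 'N_(Aut X)(Q | 'P) :&: Aut_stab chi
               = 'N_(Aut X)(Q | 'P) :&: Aut_sub_stab X psi) :
  cohomological_condition chi psi.
Proof.
(* Similar representations have the same degree, so the restrictions to V^Q
   are matrices of the size of psi. *)
have eq_m := mxrank_rsim VQ_psi; subst m.
have chQ : Q \char 'N_X(Q) by rewrite -[X in X \char _]Q_radical pcore_char.
have sSN := Aut_sub_stab_char (X := X) psi chQ.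
have sSS : Aut_sub_stab X psi \subset Aut_stab chi.
  by apply: subset_trans (subsetIr 'N_(Aut X)(Q | 'P) _); rewrite stab_eq subsetI sSN /=.
have [P [alpha [projP tP P_inner]]] := projective_intertwiner_exists chi chi_irr.
have stabP : {in Aut_sub_stab X psi, forall a,
    rfix_mx chi Q *m P a <= rfix_mx chi Q}%MS.
  move=> a Sa; have /setIP[_ nQa] := subsetP sSN a Sa.
  exact: rfix_mx_stable_intertwiner sQX nQa (tP a (subsetP sSS a Sa)).
exists P, alpha, (fun a => restrict_mx (rfix_mx chi Q) (P a)), alpha.
exists (fun c => repr c), chi, (fixed_repr chi sQX); split=> //.
- by split=> //; apply: projective_repr_restrict projP.
- split=> [|c Xc]; first exact: repr_coset1.
  have /morphimP[x _ Xx ->] := Xc.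
  by split; [exact: repr_coset_mem | exact: coset_reprK].
- by split=> //; apply: mx_rsim_refl.
- by split=> // y /setIP[Xy _]; rewrite P_inner.
Qed.
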